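(* Let $\kappa$ be an infinite cardinal and let $\lambda$ be a limit ordinal such that $|\kappa^{<\lambda}|=|\kappa|$. Let $T=\kappa^{<\lambda}\cup\kappa^{\lambda}$ be endowed with the order topology, and let $\mathcal{I}=\bigcup_{\alpha<\lambda}\mathcal{P}(\kappa^{<\alpha})$. Then the space $$CB(\kappa^{\lambda})=CB(T)/CB_{0}(T,\mathcal{I})$$ (equality meaning isometric identification induced by restriction of functions to $\kappa^\lambda$) is uniformly convex-transitive.
   Context: All Banach spaces are real. For ordinals $\alpha$, $\kappa^{\alpha}$ is the set of sequences of length $\alpha$ with entries in $\kappa$, and $\kappa^{<\alpha}=\bigcup_{\beta<\alpha}\kappa^{\beta}$. The tree $T=\kappa^{<\lambda}\cup\kappa^{\lambda}$ is partially ordered by $x\leq y$ if $x$ is an initial segment of $y$, and is endowed with the order topology, i.e. the topology generated by the open rays $\{x\in T: x>s\}$ and $\{x\in T: x<s\}$, $s\in T$ (so that basic neighbourhoods of a point $t\in\kappa^\lambda$ are the sets $\{x\in T: x>s\}$ with $s<t$). $\kappa^\lambda$ carries the subspace topology. $\mathcal{P}(A)$ denotes the power set of $A$. For a topological space $T$, $CB(T)$ is the Banach space of continuous bounded functions $T\to\mathbb{R}$ with the sup norm. For an ideal $\mathcal{I}$ of subsets of $T$, $CB_{0}(T,\mathcal{I})\subset CB(T)$ is the closed subspace of those $f$ such that $\{t\in T:\ |f(t)|\geq\epsilon\}\in\mathcal{I}$ for every $\epsilon>0$. Quotients carry the quotient norm. For a Banach space $X$, $\mathbf{S}_X$ is its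 unit sphere and $\mathcal{G}_X$ is the group of isometric (linear, surjective) automorphisms of $X$. For $x\in\mathbf{S}_X$ and $n\in\mathbb{N}$ put $C_n(x)=\{\sum_{i=1}^{n}a_iT_i(x):\ T_1,\dots,T_n\in\mathcal{G}_X,\ a_1,\dots,a_n\in[0,1],\ \sum_{i=1}^n a_i=1\}$. $X$ is uniformly convex-transitive if for each $\varepsilon>0$ there is $n\in\mathbb{N}$ such that $\mathrm{dist}(y,C_n(x))\leq\varepsilon$ for all $x,y\in\mathbf{S}_X$.
   Formalization: The isometric identification is stated with the ideal P(κ^{<λ}) in place of ⋃_{α<λ} P(κ^{<α}); for the latter it is false, as restriction also kills functions outside CB_0(T,I), and only CB_0(T,I) ⊂ kernel is stated. Uniform convex-transitivity is stated for CB(κ^λ). *)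

(* Defs.v *)
From HB Require Import structures.
From mathcomp Require Import all_boot all_order all_algebra.
From mathcomp Require Import all_classical all_reals all_analysis.
From mathcomp Require Import lra.

Set Implicit Arguments.
Unset Strict Implicit.
Unset Printing Implicit Defensive.

Import Order.TTheory GRing.Theory Num.Theory.
Import numFieldNormedType.Exports.

Local Open Scope classical_set_scope.
Local Open Scope card_scope.
Local Open Scope ring_scope.

Section bounded_continuous.
Context (R : realType) (S : topologicalType).

Definition cb_pred : {pred S -> R} :=
  mem [set f : S -> R | continuous f /\ bounded_fun f].

Record CB := MkCB { cb_fun :> S -> R; cb_funP : cb_fun \in cb_pred }.

HB.instance Definition _ := [isSub for cb_fun].
HB.instance Definition _ := gen_eqMixin CB.
HB.instance Definition _ := gen_choiceMixin CB.

Lemma cb_boundP (f : S -> R) :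
  bounded_fun f <-> exists M, forall x, `|f x| <= M.
Proof.
split=> [[M [_ fM]]|[M fM]].
  by exists (M + 1) => x; apply: (fM (M + 1)) => //; rewrite ltrDl.
by exists M; split=> [|N /ltW MN x _]; [exact: num_real | exact: le_trans MN].
Qed.

Lemma cb_continuous (f : CB) : continuous f.
Proof. by have := cb_funP f; rewrite inE => -[]. Qed.

Lemma cb_bounded (f : CB) : exists M, forall x, `|f x| <= M.
Proof. by apply/cb_boundP; have := cb_funP f; rewrite inE => -[]. Qed.

Lemma cb_submod_closed : submod_closed cb_pred.
Proof.
split=> [|a f g]; rewrite !inE.
  split; first by move=> x; exact: cst_continuous.
  by apply/cb_boundP; exists 0 => x; rewrite normr0.
move=> [cf /cb_boundP[M fM]] [cg /cb_boundP[N gN]]; split.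
  move=> x; apply: continuousD; last exact: cg.
  by apply: continuousZl_tmp; exact: cf.
apply/cb_boundP; exists (`|a| * M + N) => x.
by rewrite (le_trans (ler_normD _ _))// lerD// normrM ler_wpM2l.
Qed.

HB.instance Definition _ :=
  GRing.isSubmodClosed.Build R (S -> R) cb_pred cb_submod_closed.
HB.instance Definition _ := [SubChoice_isSubLmodule of CB by <:].

Definition sup_norm (f : CB) : R := sup [set `|f x| | x in [set: S]].

Lemma sup_norm_ge (f : CB) x : `|f x| <= sup_norm f.
Proof.
have [M fM] := cb_bounded f.
by apply: ub_le_sup; [exists M => _ [y _ <-] | exists x].
Qed.

Lemma sup_norm_le (f : CB) (M : R) :
  0 <= M -> (forall x, `|f x| <= M) -> sup_norm f <= M.
Proof.
move=> M0 fM; have [S0|/set0P[x _]] := eqVneq [set: S] set0.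
  by rewrite /sup_norm S0 image_set0 sup0.
by apply: ge_sup => [|_ [y _ <-]//]; exists `|f x|, x.
Qed.

Lemma sup_norm_ge0 (f : CB) : 0 <= sup_norm f.
Proof.
have [S0|/set0P[x _]] := eqVneq [set: S] set0.
  by rewrite /sup_norm S0 image_set0 sup0.
exact: le_trans (sup_norm_ge f x).
Qed.

Lemma sup_normD (f g : CB) : sup_norm (f + g) <= sup_norm f + sup_norm g.
Proof.
apply: sup_norm_le => [|x]; first by rewrite addr_ge0 ?sup_norm_ge0.
by rewrite (le_trans (ler_normD _ _))// lerD// sup_norm_ge.
Qed.

Lemma sup_normZ (a : R) (f : CB) : sup_norm (a *: f) = `|a| * sup_norm f.
Proof.
have le1 b (g : CB) : sup_norm (b *: g) <= `|b| * sup_norm g.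
  apply: sup_norm_le => [|x]; first by rewrite mulr_ge0 ?sup_norm_ge0.
  by rewrite [leLHS]normrM ler_wpM2l// sup_norm_ge.
apply/eqP; rewrite eq_le le1 /=.
have [->|a0] := eqVneq a 0; first by rewrite normr0 mul0r sup_norm_ge0.
rewrite -ler_pdivlMl ?normr_gt0// -normfV.
by rewrite -{1}(scalerK a0 f) le1.
Qed.

Lemma sup_norm0_eq0 (f : CB) : sup_norm f = 0 -> f = 0.
Proof.
move=> f0; apply/val_inj/funext => x /=.
by apply/eqP; rewrite -normr_le0 -f0 sup_norm_ge.
Qed.

HB.instance Definition _ :=
  Lmodule_isNormed.Build R CB sup_normD sup_normZ sup_norm0_eq0.

Lemma cb_complete (F : set_system CB) : ProperFilter F -> cauchy F -> cvg F.
Proof.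
move=> FF /cauchyP Fc.
have ev_le (f g : CB) x : `|f x - g x| <= `|f - g|.
  exact: (sup_norm_ge (f - g) x).
have Fx x : cvg ((fun h : CB => h x : R) @ F).
  apply: cauchy_cvg; apply/cauchyP => e e0; have [f Ff] := Fc e e0.
  exists (f x); rewrite /fmap /=; apply: filterS Ff => h.
  by rewrite -!ball_normE /=; apply: le_lt_trans; exact: ev_le.
pose g x : R := lim ((fun h : CB => h x : R) @ F).
have Fg (e : R) : 0 < e -> exists f : CB,
    F (ball f e) /\ forall x, `|f x - g x| <= e.
  move=> e0; have [f Ff] := Fc e e0; exists f; split=> // x.
  apply/ler_addgt0Pr => c c0.
  have /cvgr_dist_lt/(_ c c0) gx := Fx x.
  have [h [/= gh]] := filter_ex (filterI gx Ff).
  rewrite -ball_normE /= => fh.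
  rewrite -(subrKA (h x)) (le_trans (ler_normD _ _))// lerD//.
    exact: le_trans (ev_le _ _ _) (ltW fh).
  by rewrite distrC ltW.
have gP : g \in cb_pred.
  rewrite inE; split=> [x|].
    apply/cvgrPdist_lt => e e0; have e3 : 0 < e / 3 by rewrite divr_gt0.
    have [f [_ fg]] := Fg _ e3.
    have /cvgrPdist_lt/(_ _ e3) := @cb_continuous f x; apply: filterS => y /= fxy.
    have /= := fg x; have /= := fg y.
    have := ler_distD (f x) (g x) (g y); have := ler_distD (f y) (f x) (g y).
    rewrite (distrC (g x) (f x)); lra.
  have [f [_ fg]] := Fg _ ltr01; have [M fM] := cb_bounded f.
  apply/cb_boundP; exists (M + 1) => x.
  rewrite -(subrK (f x) (g x)) addrC (le_trans (ler_normD _ _))// lerD//.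
  by rewrite distrC.
apply/cvg_ex; exists (MkCB gP); apply/cvgrPdist_le => e e0.
have e2 : 0 < e / 2 by rewrite divr_gt0.
have [f [Ff fg]] := Fg _ e2; apply: filterS Ff => h.
rewrite -ball_normE /= => fh; apply: sup_norm_le; first exact: ltW.
move=> x; change (`|g x - h x| <= e).
rewrite -(subrKA (f x)) (le_trans (ler_normD _ _))// (splitr e) lerD//.
  by rewrite distrC.
exact: le_trans (ev_le _ _ _) (ltW fh).
Qed.

HB.instance Definition _ := Uniform_isComplete.Build CB cb_complete.

End bounded_continuous.

Section restriction.
Context (R : realType) (S : topologicalType) (A : set S).

Lemma cb_restr_subproof (f : CB R S) :
  (f \o set_val : A -> R) \in @cb_pred R A.
Proof.
rewrite inE; split=> [x|].
  by apply: continuous_comp; [exact: initial_continuous | exact: cb_continuous].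
by apply/cb_boundP; have [M fM] := cb_bounded f; exists M => x; exact: fM.
Qed.

Definition cb_restr (f : CB R S) : CB R A := MkCB (cb_restr_subproof f).

Lemma cb_restr_linear : linear cb_restr.
Proof. by move=> a f g; exact/val_inj. Qed.

HB.instance Definition _ :=
  GRing.isLinear.Build R (CB R S) (CB R A) _ cb_restr cb_restr_linear.

End restriction.

Definition CB0 (R : realType) (S : topologicalType) (I : set (set S)) :
    set (CB R S) :=
  [set f | forall e : R, 0 < e -> I [set t | e <= `|f t|]].

Section quotient.
Context (R : realType) (X Y : normedModType R).

(** Norm of the class of [x] in the quotient [X / N]. *)
Definition quotient_norm (N : set X) (x : X) : R := inf [set `|x - h| | h in N].

(** [u] induces a linear isometry from [X / N] onto [Y]. *)
Definition induces_isometry (N : set X) (u : {linear X -> Y}) : Prop :=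
  [/\ forall x, N x <-> u x = 0,
      forall y, exists x, u x = y
    & forall x, `|u x| = quotient_norm N x].

End quotient.

Section convex_transitive.
Context (R : realType) (X : completeNormedModType R).

Definition isometric_automorphism (u : {linear X -> X}) : Prop :=
  (forall x, `|u x| = `|x|) /\ (forall y, exists x, u x = y).

Definition orbit_hull (n : nat) (x : X) : set X :=
  [set y | exists (u : 'I_n -> {linear X -> X}) (a : 'I_n -> R),
    [/\ forall i, isometric_automorphism (u i),
        forall i, 0 <= a i <= 1,
        \sum_i a i = 1
      & y = \sum_i a i *: u i x]].

(** [edist_inf] is [+oo] for the empty set [orbit_hull 0 x]. *)
Definition uniformly_convex_transitive : Prop :=
  forall e : R, 0 < e -> exists n : nat, forall x y : X, `|x| = 1 -> `|y| = 1 ->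
    (edist_inf (orbit_hull n x) y <= e%:E)%E.

End convex_transitive.
Arguments uniformly_convex_transitive {R} X.

(** The ordinal lambda is the order type of the well-order [L], and an ordinal
  [a < lambda] is the element [a : L], identified with the initial segment
  [{b | b < a}].  A sequence of length [a <= lambda] with entries in [K] is
  a partial function from [L] to [K] whose domain is the initial segment [a];
  by well-foundedness the domains of the partial functions below are exactly
  these segments (lemma [tree_eq]). *)

Definition limit_order (d : Order.disp_t) (L : orderType d) : Prop :=
  inhabited L /\ forall a : L, exists b : L, (a < b)%O.

Section tree.
Context (K : Type) (d : Order.disp_t) (L : orderType d).

Record tree := Tree {
  entry :> L -> option K;
  entry_closed : forall a b, (a <= b)%O -> entry a = None -> entry b = None }.

(** [level a], [below a], [nodes] and [branches] are the sets of sequences of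
  length [a], of length [< a], of length [< lambda] and of length [lambda]. *)
Definition level (a : L) : set tree :=
  [set x | forall b, x b <> None <-> (b < a)%O].
Definition below (a : L) : set tree := \bigcup_(b in [set b | (b < a)%O]) level b.
Definition nodes : set tree := \bigcup_a level a.
Definition branches : set tree := [set x | forall b, x b <> None].

Lemma tree_eq : well_founded (fun a b : L => (a < b)%O) ->
  nodes `|` branches = [set: tree].
Proof.
move=> wf; apply/seteqP; split=> // x _.
have [xb|/existsNP[b /contrapT]] := pselect (branches x); first by right.
elim/(well_founded_ind wf): b => b IH xb.
have [[c [cb xc]]|min] := pselect (exists c, (c < b)%O /\ x c = None).
  exact: IH cb xc.
left; exists b => // c; split=> [xc|cb xc]; last by apply: min; exists c.
by rewrite ltNge; apply/negP => bc; apply: xc; apply: entry_closed bc xb.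
Qed.

Definition initial_segment (x y : tree) : Prop :=
  forall a, x a <> None -> y a = x a.
Definition proper_initial_segment (x y : tree) : Prop :=
  initial_segment x y /\ x <> y.

Definition open_rays : set (set tree) :=
  [set [set x | proper_initial_segment s x] | s in [set: tree]] `|`
  [set [set x | proper_initial_segment x s] | s in [set: tree]].

HB.instance Definition _ := gen_eqMixin tree.
HB.instance Definition _ := gen_choiceMixin tree.
HB.instance Definition _ := @isSubBaseTopological.Build tree
  (set tree) open_rays id.

(** The union over [a < lambda] of the power sets of [below a]. *)
Definition bounded_ideal : set (set tree) :=
  [set A | exists a, A `<=` below a].

(** The power set of the union over [a < lambda] of the sets [below a].  It is
  strictly larger than [bounded_ideal]: a node may have any length.  The
  functions vanishing on [branches] form [CB0 nodes_ideal]; in general they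
  are not all in [CB0 bounded_ideal]: with [K = L = nat], the
  indicator of the sequences [x] of length [x 0 + 1] is continuous on [tree],
  is zero on [branches] and takes the value 1 at nodes of unbounded length. *)
Definition nodes_ideal : set (set tree) := [set A | A `<=` \bigcup_a below a].

End tree.
Arguments nodes K {d} L _.
Arguments branches K {d} L _.
Arguments bounded_ideal K {d} L _.
Arguments nodes_ideal K {d} L _.

(* Main.v *)
(** Restriction.  A bounded continuous [g] on the branches extends to the tree
  by [x |-> sup over s < x of (inf of g above s)].  This is monotone along
  initial segments, hence continuous at nodes of limit length, and it is
  squeezed between the bounds of [g] above any [s < x], hence continuous at
  branches, where it agrees with [g]; its values stay within the bounds of [g].

  Convex transitivity.  Let [|f| = |g| = 1].  Up to sign, [f] is close to 1 on
  a cone of the form [{t | t > s}].  For a long enough level [a], every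
  permutation of the sequences of length [a] acts on the branches by
  homeomorphisms, and all the sets of such sequences that matter here have the
  cardinality of [K]; so for distinct [k_1, ..., k_n] in [K] there are
  homeomorphisms [h_i] sending [{t | t a0 <> k_i}] into the cone.  At each branch
  at most one [f o h_i] is not close to 1.  On the other hand [g] is within [3/n]
  of an average of [n] continuous functions [s_i] with values [1] and [-1], since
  it is nearly locally constant.  Then [g] is close to the average of the
  [s_i * (f o h_i)], uniformly in [f] and [g]. *)
Require Import Defs.
From HB Require Import structures.
From mathcomp Require Import all_boot all_order all_algebra.
From mathcomp Require Import all_classical all_reals all_analysis.
From mathcomp Require Import finmap lra.

Set Implicit Arguments.
Unset Strict Implicit.
Unset Printing Implicit Defensive.

Import Order.TTheory GRing.Theory Num.Theory.
Import numFieldNormedType.Exports.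

Local Open Scope classical_set_scope.
Local Open Scope card_scope.
Local Open Scope ring_scope.

(** * Neighbourhoods of branches in the order topology *)

Section tree_topology.
Context (K : pointedType) (d : Order.disp_t) (L : orderType d).
Hypothesis L_wf : well_founded (fun a b : L => (a < b)%O).
Hypothesis L_limit : limit_order L.

(** Generic in [X] to serve both trees, with entries in [option K], and total sequences [L -> K]. *)
Definition agree (X : Type) (a : L) (x y : L -> X) :=
  forall b, (b < a)%O -> x b = y b.

Lemma agreeC X a (x y : L -> X) : agree a x y -> agree a y x.
Proof. by move=> xy b /xy. Qed.

Lemma agree_trans X a (x y z : L -> X) :
  agree a x y -> agree a y z -> agree a x z.
Proof. by move=> xy yz b ba; rewrite xy// yz. Qed.

Lemma agreeW X a b (x y : L -> X) : (a <= b)%O -> agree b x y -> agree a x y.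
Proof. by move=> ab xy c ca; apply: xy; exact: lt_le_trans ab. Qed.

Lemma tree_inj (x y : tree K L) : (x : L -> option K) = y -> x = y.
Proof.
by case: x y => x xP [y yP] /= xy; subst y; congr Tree; exact: Prop_irrelevance.
Qed.

Lemma entryW (x : tree K L) a b : (a <= b)%O -> x b <> None -> x a <> None.
Proof. by move=> ab xb xa; apply: xb; exact: entry_closed ab xa. Qed.

Lemma cut_subproof a (x : tree K L) b c : (b <= c)%O ->
  (if (b < a)%O then x b else None) = None ->
  (if (c < a)%O then x c else None) = None.
Proof.
move=> bc; case: ifPn => [_ xb|]; first by rewrite (entry_closed bc xb) if_same.
by rewrite -leNgt => ab _; rewrite ltNge (le_trans ab bc).
Qed.

Definition cut a (x : tree K L) : tree K L := Tree (@cut_subproof a x).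

Lemma branch_subproof (phi : L -> K) a b : (a <= b)%O ->
  Some (phi a) = None -> Some (phi b) = None.
Proof. by []. Qed.

Definition branch_tree (phi : L -> K) : tree K L := Tree (@branch_subproof phi).

Lemma branch_treeP phi : branch_tree phi \in branches K L.
Proof. exact/mem_set. Qed.

Definition branch (phi : L -> K) : branches K L := SigSub (branch_treeP phi).

Definition fill (x : tree K L) : L -> K := fun a => odflt point (x a).

Lemma branchesP (t : branches K L) a : val t a <> None.
Proof. exact: set_mem (valP t) a. Qed.

Lemma fillE (x : tree K L) a : x a <> None -> Some (fill x a) = x a.
Proof. by rewrite /fill; case: (x a). Qed.

Lemma agree_fill (x : tree K L) a :
  x a <> None -> agree a (val (branch (fill x))) x.
Proof. by move=> xa b /ltW ba; rewrite /= fillE//; exact: entryW ba xa. Qed.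

(** Since [x] has an entry at [a], the cut has length exactly [a], so a proper extension of it must
    have an entry at [a] too. *)
Lemma proper_cut (x y : tree K L) a : x a <> None ->
  proper_initial_segment (cut a x) y <-> agree a x y /\ y a <> None.
Proof.
move=> xa; split=> [[sxy nxy]|[xy ya]].
  have xy : agree a x y.
    move=> b ba; rewrite sxy/= ba//; exact: entryW (ltW ba) xa.
  split=> // ya; apply/nxy/tree_inj/funext => b /=; case: ltP => [|ab].
    exact: xy.
  by rewrite (entry_closed ab ya).
split=> [b /=|/(congr1 (fun z : tree K L => z a))]/=.
  by case: ltP => // ba _; rewrite xy.
by rewrite ltxx => /esym.
Qed.

Lemma open_above (s : tree K L) : open [set x | proper_initial_segment s x].
Proof.
exists [set [set x | proper_initial_segment s x]]; last by rewrite bigcup_set1.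
by move=> _ ->; apply: finI_from1; left; exists s.
Qed.

Lemma open_under (s : tree K L) : open [set x | proper_initial_segment x s].
Proof.
exists [set [set x | proper_initial_segment x s]]; last by rewrite bigcup_set1.
by move=> _ ->; apply: finI_from1; right; exists s.
Qed.

Lemma tree_openE (O : set (tree K L)) : open O <->
  exists2 D, D `<=` finI_from (@open_rays K d L) id & \bigcup_(i in D) i = O.
Proof. by split. Qed.

(** A branch is maximal, so it lies in no downward ray. It lies in the upward ray of [s] only if [s]
    stops at some [a], and this [a] serves for that ray. The maximum over the finitely many rays
    serves for all of them. *)
Lemma finI_branch (A : set (tree K L)) (t : tree K L) :
  finI_from (@open_rays K d L) id A -> A t -> branches K L t ->
  exists a, forall u : tree K L, agree a t u -> u a <> None -> A u.
Proof.
have [[a0] _] := L_limit.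
move=> [F FD <-] Ft tB.
have H i : exists a, i \in F ->
    forall u : tree K L, agree a t u -> u a <> None -> i u.
  have [iF|/negP] := boolP (i \in F); last by exists a0.
  have it := Ft _ iF.
  have /set_mem [[s _ si]|[s _ si]] := FD _ iF.
    move: it; rewrite -si /= => -[st nst].
    have [a sa] : exists a, s a = None.
      apply: contrapT => sN; apply/nst/tree_inj/funext => a.
      by rewrite st// => sa; apply: sN; exists a.
    exists a => _ u tu ua; split=> [b sb|su].
      rewrite -(st _ sb); apply/esym/tu; rewrite ltNge; apply/negP => ab.
      exact/sb/(entry_closed ab).
    by apply: ua; rewrite -su.
  move: it; rewrite -si /= => -[st nst].
  case: nst; apply/tree_inj/funext => a; apply/esym/st; exact: tB.
have {H}[h hP] := choice H.
exists (\big[Order.max/a0]_(i <- F) h i) => u tu ua i /= iF.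
have hi : (h i <= \big[Order.max/a0]_(i <- F) h i)%O by exact: le_bigmax_seq.
by apply: hP => //; [exact: agreeW tu | exact: entryW ua].
Qed.

Lemma open_branch (O : set (tree K L)) (t : tree K L) :
  open O -> O t -> branches K L t ->
  exists a, forall u : tree K L, agree a t u -> u a <> None -> O u.
Proof.
move=> /tree_openE[D DI <-] [A DA At] tB.
have [a aP] := finI_branch (DI _ DA) At tB.
by exists a => u tu ua; exists A => //; exact: aP.
Qed.

Lemma nbhs_branches (t : branches K L) (A : set (branches K L)) :
  nbhs t A <->
  exists a, forall u : branches K L, agree a (val t) (val u) -> A u.
Proof.
split=> [|[a aP]].
  rewrite nbhsE => -[_ [[V Vo <-] Vt] VA].
  have [a aP] := open_branch Vo Vt (set_mem (valP t)).
  by exists a => u tu; apply: VA; apply: aP => //; exact: branchesP.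
rewrite nbhsE; exists (set_val @^-1`
    [set x | proper_initial_segment (cut a (val t)) x]).
  split; first by exists [set x | proper_initial_segment (cut a (val t)) x];
    [exact: open_above|].
  by apply/proper_cut; [exact: branchesP | split=> //; exact: branchesP].
by move=> u /proper_cut[|tu _]; [exact: branchesP | exact: aP].
Qed.

End tree_topology.

(** * Extension of functions from the branches to the tree *)

Section extension.
Context (R : realType) (K : pointedType) (d : Order.disp_t) (L : orderType d).
Hypothesis L_wf : well_founded (fun a b : L => (a < b)%O).
Hypothesis L_limit : limit_order L.
Variable g : CB R (branches K L).

Definition cone_inf (x : tree K L) (a : L) : R :=
  inf [set g t | t in [set t : branches K L | agree a x (val t)]].

(* At the empty sequence this is [sup set0 = 0]. *)
Definition extension (x : tree K L) : R :=
  sup [set cone_inf x a | a in [set a | x a <> None]].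

Lemma cone_inf_agree (x y : tree K L) a :
  agree a x y -> cone_inf x a = cone_inf y a.
Proof.
move=> xy; congr (inf (_ @` _)); apply/seteqP; split=> t /=.
  exact: agree_trans (agreeC xy).
exact: agree_trans.
Qed.

Lemma cone_inf_le (x : tree K L) a (t : branches K L) :
  agree a x (val t) -> cone_inf x a <= g t.
Proof.
move=> xt; have [M gM] := cb_bounded g; apply: ge_inf; last by exists t.
by exists (- M) => _ [u _ <-]; have := gM u; rewrite ler_norml => /andP[].
Qed.

Lemma cone_inf_ge (x : tree K L) a (m : R) : x a <> None ->
  (forall t : branches K L, agree a x (val t) -> m <= g t) -> m <= cone_inf x a.
Proof.
move=> xa mg; apply: lb_le_inf; last by move=> _ [t xt <-]; exact: mg.
(* The cone is nonempty, so [inf] does not take its default value. *)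
exists (g (branch (fill x))), (branch (fill x)) => //=.
exact/agreeC/agree_fill.
Qed.

Lemma cone_inf_extension (x : tree K L) a :
  x a <> None -> cone_inf x a <= extension x.
Proof.
move=> xa; have [M gM] := cb_bounded g; apply: ub_le_sup; last by exists a.
exists M => _ [b xb <-].
have := cone_inf_le (agreeC (agree_fill xb)); move=> /le_trans; apply.
exact: le_trans (ler_norm _) (gM _).
Qed.

(** The term at [a] gives the lower bound. For the upper bound, every term is at most the value of
    [g] at the one branch [branch (fill x)], which also lies in the cone at [a]. *)
Lemma extension_bounds (x : tree K L) a lo hi : x a <> None ->
  (forall t : branches K L, agree a x (val t) -> lo <= g t <= hi) ->
  lo <= extension x <= hi.
Proof.
move=> xa gx; apply/andP; split.
  apply: le_trans (cone_inf_extension xa); apply: cone_inf_ge => // t xt.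
  by case/andP: (gx _ xt).
apply: ge_sup => [|_ [b xb <-]]; first by exists (cone_inf x a), a.
have := cone_inf_le (agreeC (agree_fill xb)); move=> /le_trans; apply.
by case/andP: (gx _ (agreeC (agree_fill xa))).
Qed.

(** For [a] the length of [x], found by well-foundedness, append the entry [point] at [a]: the open
    ray below the result consists of initial segments of [x]. *)
Lemma nbhs_node (x : tree K L) a : x a = None ->
  \forall y \near x, initial_segment y x.
Proof.
elim/(well_founded_ind L_wf): a => a IH xa.
have [[c [ca xc]]|min] := pselect (exists c, (c < a)%O /\ x c = None).
  exact: IH ca xc.
pose e b := if (b == a)%O then Some (point : K) else x b.
have eP b c : (b <= c)%O -> e b = None -> e c = None.
  rewrite /e; case: eqVneq => // ba bc xb; case: eqVneq => [ca|_].
    case: min; exists b; split=> //.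
    by rewrite lt_neqAle ba -ca.
  exact: entry_closed bc xb.
apply: (@filterS _ _ (nbhs_filter _)
  [set y | proper_initial_segment y (Tree eP)]); last first.
  apply: open_nbhs_nbhs; split; first exact: open_under.
  split=> [b xb /=|].
    by rewrite /e; case: eqVneq => // ba; rewrite ba in xb.
  by move=> /(congr1 (fun z : tree K L => z a)) /=; rewrite xa /e eqxx.
(* An entry of [y] at [a] would make [y] the whole one-entry extension, which the ray excludes. *)
move=> y [ye nye] b yb; have := ye _ yb; rewrite /= /e.
case: eqVneq => // ba _; case: nye; apply/tree_inj/funext => c /=.
have yE c' : y c' <> None -> y c' = e c' by move=> /ye.
have [/yE//|/contrapT yc] := pselect (y c <> None).
rewrite yc /e; case: eqVneq => [ca|_]; first by case: yb; rewrite ba -ca.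
have [ca|/ltW ac] := leP c a; last by rewrite (entry_closed ac xa).
by case: (entryW ca _ yc); rewrite -ba.
Qed.

Lemma extension_near (t : branches K L) (e : R) : 0 < e ->
  exists a, forall y : tree K L, agree a (val t) y -> y a <> None ->
    `|g t - extension y| <= e.
Proof.
move=> e0; have /cvgrPdist_le/(_ e e0)/(nbhs_branches L_limit)[a aP] :=
  @cb_continuous _ _ g t.
exists a => y ty ya; rewrite ler_distlC; apply: extension_bounds ya _ => u yu.
by rewrite -ler_distlC; apply: aP; exact: agree_trans ty yu.
Qed.

Lemma extension_branch (t : branches K L) : extension (val t) = g t.
Proof.
apply/eqP; rewrite eq_sym -subr_eq0 -normr_le0; apply/ler_addgt0Pr => e e0.
have [a aP] := extension_near t e0.
by rewrite add0r; apply: aP => //; exact: branchesP.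
Qed.

Lemma extension_norm x : `|extension x| <= sup_norm g.
Proof.
have [[a xa]|xN] := pselect (exists a, x a <> None).
  rewrite ler_norml; apply: (extension_bounds xa) => t _.
  by rewrite -ler_norml sup_norm_ge.
rewrite /extension (_ : [set a | _] = set0).
  by rewrite image_set0 sup0 normr0 sup_norm_ge0.
by apply/seteqP; split=> // a xa; apply: xN; exists a.
Qed.

Lemma extension_continuous : continuous extension.
Proof.
move=> x; have ? : Filter (nbhs x) := nbhs_filter x.
apply/cvgrPdist_le => e e0.
have [xB|/existsNP[a /contrapT xa]] := pselect (branches K L x).
  pose t : branches K L := SigSub (mem_set xB).
  have [a aP] := extension_near t e0.
  apply: (@filterS _ _ (nbhs_filter _)
    [set y | proper_initial_segment (cut a x) y]).
    move=> y /proper_cut[|xy ya]; first exact: xB.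
    by rewrite -[x]/(val t) extension_branch; exact: aP.
  apply: open_nbhs_nbhs; split; first exact: open_above.
  by apply/proper_cut; [exact: xB | split=> //; exact: xB].
have xx := nbhs_node xa.
(* The empty sequence is isolated: it is its own only initial segment. *)
have [[c xc]|xN] := pselect (exists c, x c <> None); last first.
  apply: filterS xx => y yx; suff -> : y = x by rewrite subrr normr0 ltW.
  apply/tree_inj/funext => c; have [yc|yc] := pselect (y c <> None).
    by rewrite (yx _ yc).
  move/contrapT: yc => ->; apply: contrapT => xc.
    by apply: xN; exists c => /esym.
have [M gM] := cb_bounded g.
have hs : has_sup [set cone_inf x a | a in [set a | x a <> None]].
  split; first by exists (cone_inf x c), c.
  exists M => _ [b xb <-].
  have := cone_inf_le (agreeC (agree_fill xb)); move=> /le_trans; apply.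
  exact: le_trans (ler_norm _) (gM _).
(* The term at [b] is within [e] of the supremum. Any [y] between [cut b x] and [x] keeps this term,
   and monotonicity gives the upper bound. *)
have [_ [b xb <-] xeb] := sup_adherent e0 hs.
have xxb : \forall y \near x, proper_initial_segment (cut b x) y.
  apply: open_nbhs_nbhs; split; first exact: open_above.
  by apply/proper_cut.
apply: filterS2 xx xxb => y yx /proper_cut[//|xy yb].
have le1 : cone_inf x b <= extension y.
  by rewrite (cone_inf_agree xy); exact: cone_inf_extension.
have le2 : extension y <= extension x.
  apply: ge_sup => [|_ [c' yc <-]]; first by exists (cone_inf y b), b.
  rewrite (@cone_inf_agree y x); last first.
    by move=> b' b'c; rewrite -yx//; exact: entryW (ltW b'c) yc.
  by apply: cone_inf_extension; rewrite (yx _ yc).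
rewrite -/(extension x) in xeb.
by rewrite ger0_norm ?subr_ge0//; lra.
Qed.

Lemma extension_cb : extension \in @cb_pred R (tree K L).
Proof.
apply/mem_set; split; first exact: extension_continuous.
by apply/cb_boundP; exists (sup_norm g) => x; exact: extension_norm.
Qed.

Definition cb_extension : CB R (tree K L) := MkCB extension_cb.

Lemma cb_extensionK : cb_restr (branches K L) cb_extension = g.
Proof. by apply/val_inj/funext => t; exact: extension_branch. Qed.

Lemma cb_extension_norm : `|cb_extension| <= `|g|.
Proof.
by apply: sup_norm_le => [|x]; [exact: sup_norm_ge0 | exact: extension_norm].
Qed.

End extension.

(** * Restriction to the branches as a quotient map *)

Section restriction_quotient.
Context (R : realType) (K : pointedType) (d : Order.disp_t) (L : orderType d).
Hypothesis L_wf : well_founded (fun a b : L => (a < b)%O).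
Hypothesis L_limit : limit_order L.

Lemma below_not_branch a (x : tree K L) : below a x -> ~ branches K L x.
Proof. by move=> [b _ xb] /(_ b) /xb; rewrite ltxx. Qed.

(** A node of length [a] lies in [below b] for any [b] above [a], and such a [b] exists at a
    limit. *)
Lemma nodes_idealE : @nodes_ideal K _ L = [set A | A `<=` ~` branches K L].
Proof.
have [_ lim] := L_limit.
apply/seteqP; split=> A /= AS x /AS; first by move=> [a _ /below_not_branch].
have : [set: tree K L] x by [].
rewrite -(tree_eq K L_wf) => -[[a _ xa] _|//].
by have [b ab] := lim a; exists b => //; exists a.
Qed.

(** Stated for every [I] inside [nodes_ideal] so as to cover [bounded_ideal] as well. *)
Lemma CB0_restr (I : set (set (tree K L))) (f : CB R (tree K L)) :
  I `<=` nodes_ideal K L -> CB0 I f -> cb_restr (branches K L) f = 0.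
Proof.
rewrite nodes_idealE => IN If; apply/val_inj/funext => t /=.
apply/eqP; rewrite -normr_le0 leNgt; apply/negP => ft.
by apply: (IN _ (If _ ft) (val t)) (set_mem (valP t)) => /=.
Qed.

Lemma CB0_nodesE (f : CB R (tree K L)) :
  CB0 (nodes_ideal K L) f <-> cb_restr (branches K L) f = 0.
Proof.
split=> [|f0]; first exact: CB0_restr.
rewrite nodes_idealE => e e0 x /= fx xB.
have /(congr1 (fun h : CB R (branches K L) => h (SigSub (mem_set xB)))) := f0.
by move=> /= fx0; move: fx; rewrite fx0 normr0 leNgt e0.
Qed.

Lemma restr_induces_isometry :
  induces_isometry (CB0 (nodes_ideal K L))
    (@cb_restr R (tree K L) (branches K L)).
Proof.
split=> [f|g|f]; first exact: CB0_nodesE.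
  by exists (cb_extension L_wf L_limit g); exact: cb_extensionK.
pose u : {linear CB R (tree K L) -> CB R (branches K L)} :=
  @cb_restr R (tree K L) (branches K L).
have le_u h : `|u h| <= `|h|.
  apply: sup_norm_le => [|t]; first exact: sup_norm_ge0.
  exact: (sup_norm_ge h (val t)).
(* [F] restricts to [u f] with no larger norm, so [f - F] is in the kernel and realises the distance
   from [f] to it. *)
pose F := cb_extension L_wf L_limit (u f).
have FE : u F = u f by exact: cb_extensionK.
apply/eqP; rewrite eq_le; apply/andP; split.
  apply: lb_le_inf => [|_ [h /CB0_nodesE h0 <-]].
    by exists `|f - 0|, 0 => //; apply/CB0_nodesE; exact: (linear0 u).
  by rewrite (le_trans _ (le_u _))// linearB [u h]h0 subr0.
apply: le_trans (cb_extension_norm L_wf L_limit (u f)).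
apply: ge_inf; first by exists 0 => _ [h _ <-].
exists (f - F); last by rewrite subKr.
by apply/CB0_nodesE; rewrite -[LHS]/(u _) linearB FE subrr.
Qed.

Lemma bounded_ideal_nodes : bounded_ideal K L `<=` nodes_ideal K L.
Proof. by move=> A [a Aa] x /Aa xa; exists a. Qed.

End restriction_quotient.

(** * Isometries given by a sign weight and a homeomorphism *)

Section weighted_composition.
Context (R : realType) (S : topologicalType).
Implicit Types (s : S -> R) (h : S -> S) (f : CB R S).

Lemma weighted_comp_cb s h f : continuous s -> continuous h ->
  (forall x, `|s x| = 1) -> (fun x => s x * f (h x)) \in @cb_pred R S.
Proof.
move=> sc hc us; apply/mem_set; split=> [x|].
  apply: cvgM; first exact: sc.
  by apply: (@continuous_comp _ _ _ h f); [exact: hc | exact: cb_continuous].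
have [M fM] := cb_bounded f.
by apply/cb_boundP; exists M => x; rewrite normrM us mul1r.
Qed.

Definition weighted_comp s h (sc : continuous s) (hc : continuous h)
  (us : forall x, `|s x| = 1) f : CB R S := MkCB (weighted_comp_cb f sc hc us).

Lemma weighted_comp_linear s h sc hc us : linear (@weighted_comp s h sc hc us).
Proof.
move=> a f g; apply/val_inj/funext => x /=.
change (s x * (a * f (h x) + g (h x)) = a * (s x * f (h x)) + s x * g (h x)).
by rewrite mulrDr mulrCA.
Qed.

HB.instance Definition _ s h sc hc us :=
  GRing.isLinear.Build R (CB R S) (CB R S) _ (@weighted_comp s h sc hc us)
    (@weighted_comp_linear s h sc hc us).

(** The inverse is composition with [h'] weighted by [s \o h'], because the square of [s] is 1. *)
Lemma weighted_comp_isometric s h h' sc hc us :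
  continuous h' -> cancel h h' -> cancel h' h ->
  isometric_automorphism (@weighted_comp s h sc hc us).
Proof.
move=> h'c hK h'K; split=> [f|f].
  apply/eqP; rewrite eq_le; apply/andP; split; apply: sup_norm_le => [|x];
    rewrite ?sup_norm_ge0//.
    by rewrite /= normrM us mul1r sup_norm_ge.
  rewrite -[x]h'K; apply: le_trans (sup_norm_ge _ (h' x)).
  by rewrite /= normrM us mul1r.
have sc' : continuous (s \o h').
  by move=> x; apply: continuous_comp; [exact: h'c | exact: sc].
have us' x : `|(s \o h') x| = 1 by rewrite /= us.
exists (weighted_comp sc' h'c us' f); apply/val_inj/funext => x /=.
rewrite hK mulrA -expr2 -[_ ^+ 2]real_normK ?num_real// us expr1n mul1r//.
Qed.

End weighted_composition.

(** * Permutations obtained from equal cardinalities *)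

Section cardinals.

Lemma inj_fun_card_le T U (A : set T) (B : set U) (f : T -> U) :
  set_fun A B f -> set_inj A f -> A #<= B.
Proof.
move=> fAB fI; have [i] : $|{injfun A >-> B}| by apply/injfunPex; exists f.
exact: inj_card_le i.
Qed.

(** Glue a bijection between the parts of [Q] inside [P] and [P'] with one between the parts
    outside. *)
Lemma card_eq_permutation (T : pointedType) (Q P P' : set T) :
  Q `&` P #= Q `&` P' -> Q `&` ~` P #= Q `&` ~` P' ->
  exists p q : T -> T,
    [/\ set_fun Q Q p, set_fun Q Q q, {in Q, cancel p q}, {in Q, cancel q p}
      & forall x, Q x -> P x -> P' (p x)].
Proof.
move=> /ppcard_eqP[f] /ppcard_eqP[f'].
pose p x := if `[< P x >] then f x else f' x.
pose q x := if `[< P' x >] then f^-1%FUN x else f'^-1%FUN x.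
have pP x : Q x -> P x -> (Q `&` P') (f x).
  by move=> Qx Px; apply: (@funS _ _ _ _ f).
have pN x : Q x -> ~ P x -> (Q `&` ~` P') (f' x).
  by move=> Qx Px; apply: (@funS _ _ _ _ f').
have qP x : Q x -> P' x -> (Q `&` P) (f^-1%FUN x).
  by move=> Qx Px; apply: (@funS _ _ _ _ f^-1%FUN).
have qN x : Q x -> ~ P' x -> (Q `&` ~` P) (f'^-1%FUN x).
  by move=> Qx Px; apply: (@funS _ _ _ _ f'^-1%FUN).
exists p, q; split=> [x Qx|x Qx|x /set_mem Qx|x /set_mem Qx|x Qx Px].
- by rewrite /p; case: asboolP => Px; [case: (pP _ Qx Px)|case: (pN _ Qx Px)].
- by rewrite /q; case: asboolP => Px; [case: (qP _ Qx Px)|case: (qN _ Qx Px)].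
- rewrite /p /q; case: (asboolP (P x)) => Px.
    rewrite asboolT; last by case: (pP _ Qx Px).
    by rewrite funK//; apply/mem_set.
  rewrite asboolF; last by case: (pN _ Qx Px).
  by rewrite funK//; apply/mem_set.
- rewrite /p /q; case: (asboolP (P' x)) => Px.
    rewrite asboolT; last by case: (qP _ Qx Px).
    by rewrite invK//; apply/mem_set.
  rewrite asboolF; last by case: (qN _ Qx Px).
  by rewrite invK//; apply/mem_set.
- by rewrite /p asboolT//; case: (pP _ Qx Px).
Qed.

End cardinals.

(** * Homeomorphisms of the branches from permutations of a level *)

Section branch_homeomorphisms.
Context (K : pointedType) (d : Order.disp_t) (L : orderType d).
Hypothesis L_limit : limit_order L.

Lemma agree_fillE a (x y : tree K L) : x a <> None -> y a <> None ->
  agree a (fill x) (fill y) <-> agree a x y.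
Proof.
move=> xa ya; split=> xy b ba; last by rewrite /fill xy.
rewrite -fillE; last exact: entryW (ltW ba) xa.
rewrite -[RHS]fillE; last exact: entryW (ltW ba) ya.
by rewrite xy.
Qed.

Lemma fill_inj (t u : branches K L) : fill (val t) = fill (val u) -> t = u.
Proof.
move=> tu; apply/val_inj/tree_inj/funext => a.
by rewrite -fillE ?tu ?fillE//; exact: branchesP.
Qed.

Definition trunc a (phi : L -> K) : L -> K :=
  fun b => if (b < a)%O then phi b else point.

Definition truncated a : set (L -> K) := [set phi | trunc a phi = phi].

Lemma trunc_agree a phi psi : agree a phi psi -> trunc a phi = trunc a psi.
Proof. by move=> pp; apply/funext => b; rewrite /trunc; case: ltP => // /pp. Qed.

Lemma truncatedP a phi : truncated a (trunc a phi).
Proof. by apply: trunc_agree => b ba; rewrite /trunc ba. Qed.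

(** Cantor-Bernstein: cutting at [a] injects the set into the nodes, and the sequences following
    [psi] before [c] and equal to [k] from [c] on differ at [c] for distinct [k]. *)
Lemma card_truncated a c (P : set (L -> K)) (psi : L -> K) :
  nodes K L #= [set: K] -> (c < a)%O ->
  (forall k, P (trunc a (fun b => if (b < c)%O then psi b else k))) ->
  truncated a `&` P #= [set: K].
Proof.
move=> card_nodes ca PK; apply/card_eqPle; split; last first.
  apply: (@inj_fun_card_le _ _ _ _
    (fun k => trunc a (fun b => if (b < c)%O then psi b else k))).
    by move=> k _; split; [exact: truncatedP | exact: PK].
  by move=> k l _ _ /(congr1 (fun phi => phi c)); rewrite /trunc ca ltxx.
have /card_eqPle[+ _] := card_nodes; apply: card_le_trans.
apply: (@inj_fun_card_le _ _ _ _ (fun phi => cut a (branch_tree phi))).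
  move=> phi _; exists a => // b /=.
  by case: ltP.
move=> phi psi' /set_mem[<- _] /set_mem[<- _] E; apply/funext => b.
have := congr1 (fun x : tree K L => x b) E; rewrite /= /trunc.
by case: ltP => // _ [].
Qed.

(* Applies [p] to the first [a] entries of [t]; sequences of length [a] are
  encoded as functions with value [point] from [a] on. *)
Definition act a (p : (L -> K) -> L -> K) (t : branches K L) : branches K L :=
  branch (fun b => if (b < a)%O then p (trunc a (fill (val t))) b
                   else fill (val t) b).

Lemma act_trunc a p t : set_fun (truncated a) (truncated a) p ->
  trunc a (fill (val (act a p t))) = p (trunc a (fill (val t))).
Proof.
move=> pa; rewrite -[RHS](pa _ (truncatedP _ _)).
by apply: trunc_agree => b ba; rewrite [LHS]/fill /= ba.
Qed.

Lemma actK a p q : set_fun (truncated a) (truncated a) p ->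
  {in truncated a, cancel p q} -> cancel (act a p) (act a q).
Proof.
move=> pa pK t; apply/fill_inj/funext => b.
rewrite [LHS]/fill /= act_trunc// pK; last exact/mem_set/truncatedP.
by rewrite {1}/trunc; case: ltP => // ab; rewrite [LHS]/fill /= ltNge ab.
Qed.

Lemma act_continuous a p : continuous (act a p).
Proof.
move=> t A /(nbhs_branches L_limit)[b bA]; apply/(nbhs_branches L_limit).
(* Agreement below [a] gives [p] the same argument; agreement below [b] settles the entries that are
   left unchanged. *)
exists (Order.max a b) => u tu; apply: bA => c cb /=.
have tru : trunc a (fill (val t)) = trunc a (fill (val u)).
  apply: trunc_agree; apply/agree_fillE; try exact: branchesP.
  by apply: agreeW tu; rewrite le_max lexx.
by rewrite tru /fill (tu c)// lt_max cb orbT.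
Qed.

Lemma homeomorphism_into_cone (t : branches K L) b a0 (k0 : K) :
  infinite_set [set: K] -> nodes K L #= [set: K] ->
  exists h h' : branches K L -> branches K L,
    [/\ continuous h, continuous h', cancel h h', cancel h' h
      & forall u : branches K L,
          val u a0 <> Some k0 -> agree b (val t) (val (h u))].
Proof.
move=> /infiniteP/pcard_injP[k kI] card_nodes.
have other (x : K) : exists y, y <> x.
  have [k0x|] := pselect (k 0%N = x); last by exists (k 0%N).
  exists (k 1%N) => k1x.
  by have := kI 0%N 1%N (mem_set I) (mem_set I) (etrans k0x (esym k1x)).
have [_ lim] := L_limit.
(* With [b'] strictly above [b], some sequence disagrees with [t] before [b'] even if [b] is least.
   Entries before [c] decide both [P] and [P'], and the free entry at [c] yields as many sequences
   as [K] has elements. *)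
have [b' bb'] := lim b; have [c] := lim (Order.max b' a0).
rewrite gt_max => /andP[b'c a0c]; have [a ca] := lim c.
pose P := [set phi : L -> K | phi a0 <> k0].
pose P' := [set phi : L -> K | agree b' (fill (val t)) phi].
have a0a : (a0 < a)%O by exact: lt_trans ca.
have cP : truncated a `&` P #= [set: K].
  have [k1 k10] := other k0.
  apply: (card_truncated (psi := fun=> k1) card_nodes ca) => k'.
  by rewrite /P /= /trunc a0a a0c.
have cP' : truncated a `&` P' #= [set: K].
  apply: (card_truncated (psi := fill (val t)) card_nodes ca) => k' e eb'.
  by rewrite /trunc (lt_trans eb' (lt_trans b'c ca)) (lt_trans eb' b'c).
have cN : truncated a `&` ~` P #= [set: K].
  apply: (card_truncated (psi := fun=> k0) card_nodes ca) => k'.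
  by rewrite /P /= /trunc a0a a0c.
have cN' : truncated a `&` ~` P' #= [set: K].
  have [k1 k1t] := other (fill (val t) b).
  apply: (card_truncated (psi := fun=> k1) card_nodes ca) => k' /(_ _ bb').
  rewrite /trunc (lt_trans bb' (lt_trans b'c ca)) (lt_trans bb' b'c).
  exact/nesym.
have [p [q [pa qa pK qK pP]]] := card_eq_permutation
  (card_eq_trans cP (card_esym cP')) (card_eq_trans cN (card_esym cN')).
exists (act a p), (act a q); split; try exact: act_continuous.
- exact: actK.
- exact: actK.
move=> u ua; apply/agree_fillE; try exact: branchesP.
have := pP _ (truncatedP a (fill (val u))); rewrite -act_trunc// => H e eb.
have eb' := lt_trans eb bb'.
rewrite (H _ _ eb') /trunc ?(lt_trans eb' (lt_trans b'c ca))// /P /= a0a => uk.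
by apply: ua; rewrite -fillE ?uk//; exact: branchesP.
Qed.

End branch_homeomorphisms.

(** * Counting thresholds and exceptional indices *)

Section step_count.
Context (R : realType).

(** The sum is the ceiling of [v]. *)
Lemma count_below (n : nat) (v : R) : 0 <= v -> v <= n%:R ->
  v <= \sum_(i < n) (i%:R < v)%R%:R <= v + 1.
Proof.
move=> v0; have full m : m%:R <= v -> \sum_(i < m) (i%:R < v)%R%:R = m%:R :> R.
  move=> mv; rewrite (eq_bigr (fun=> 1)) ?sumr_const ?card_ord// => i _.
  by rewrite (lt_le_trans _ mv)// ltr_nat.
elim: n => [|n IH] vn; first by rewrite big_ord0; lra.
rewrite big_ord_recr /=; have [nv|vn'] := ltP n%:R v; last first.
  by rewrite addr0 IH.
by rewrite -natr1 in vn; rewrite (full _ (ltW nv)) /=; lra.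
Qed.

Lemma sum_indicator_le1 (n : nat) (P : pred 'I_n) :
  (forall i j, P i -> P j -> i = j) -> \sum_i (P i)%:R <= (1 : R).
Proof.
move=> Pu; have [i Pi|P0] := pickP P; last first.
  by rewrite big1 => [|i _]; rewrite ?P0.
rewrite (bigD1 i)//= Pi big1 ?addr0// => j ji.
by case: (boolP (P j)) => // Pj; rewrite (Pu _ _ Pj Pi) eqxx in ji.
Qed.

End step_count.

(** * Approximation by averages of continuous sign functions *)

Section sign_averages.
Context (R : realType) (K : pointedType) (d : Order.disp_t) (L : orderType d).
Hypothesis L_wf : well_founded (fun a b : L => (a < b)%O).
Hypothesis L_limit : limit_order L.

Lemma least_element (P : L -> Prop) : (exists a, P a) ->
  exists a, P a /\ forall b, P b -> (a <= b)%O.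
Proof.
move=> [a]; elim/(well_founded_ind L_wf): a => a IH Pa.
have [[b [ba Pb]]|min] := pselect (exists b, (b < a)%O /\ P b).
  exact: IH ba Pb.
exists a; split=> // b Pb; rewrite leNgt; apply/negP => ba.
by apply: min; exists b.
Qed.

Definition locally_constant T (G : branches K L -> T) :=
  forall t : branches K L, exists a, forall u : branches K L,
    agree a (val t) (val u) -> G u = G t.

Lemma locally_constant_continuous (G : branches K L -> R) :
  locally_constant G -> continuous G.
Proof.
move=> Gc t; have ? : Filter (nbhs t) := nbhs_filter t.
apply/cvgrPdist_le => e e0; apply/(nbhs_branches L_limit).
have [a aP] := Gc t; exists a => u /aP ->.
by rewrite subrr normr0 ltW.
Qed.

(** Let [m t] be the least level at which [g] oscillates by at most [e] on the cone of [t]. The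
    cones at these levels partition the branches, and [r] picks in each the branch continued by
    [point]. *)
Lemma locally_constant_approx (g : CB R (branches K L)) (e : R) : 0 < e ->
  exists r : branches K L -> branches K L,
    locally_constant r /\ forall t, `|g t - g (r t)| <= e.
Proof.
move=> e0; pose P (t : branches K L) a := forall u v : branches K L,
  agree a (val t) (val u) -> agree a (val t) (val v) -> `|g u - g v| <= e.
have H t : exists a, P t a /\ forall b, P t b -> (a <= b)%O.
  apply: least_element; have e2 : 0 < e / 2 by rewrite divr_gt0.
  have /cvgrPdist_le/(_ _ e2)/(nbhs_branches L_limit)[a aP] :=
    @cb_continuous _ _ g t.
  exists a => u v /aP tu /aP tv; rewrite -(subrKA (g t)) (splitr e).
  by rewrite (le_trans (ler_normD _ _))// lerD// distrC.
have [m mP] := choice H.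
exists (fun t => branch (trunc (m t) (fill (val t)))); split=> t.
  exists (m t) => u tu.
  (* Each of [m u] and [m t] is admissible for the other branch, so minimality gives both
     inequalities. *)
  have mm : m u = m t.
    have ut : (m u <= m t)%O.
      apply: (mP u).2 => v w uv uw.
      by apply: (mP t).1; apply: agree_trans tu _.
    apply/eqP; rewrite eq_le ut; apply: (mP t).2 => v w tv tw.
    by apply: (mP u).1; apply: agree_trans (agreeC (agreeW ut tu)) _.
  rewrite mm; congr branch; apply: trunc_agree; apply: agreeC.
  by apply/agree_fillE => //; exact: branchesP.
apply: (mP t).1 => // b bm.
by rewrite /= /trunc bm fillE//; exact: branchesP.
Qed.

Lemma sign_average (g : CB R (branches K L)) (n : nat) : `|g| = 1 ->
  exists s : 'I_n.+1 -> branches K L -> R,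
    [/\ forall i, continuous (s i), forall i t, `|s i t| = 1
      & forall t, `|g t - n.+1%:R^-1 * \sum_i s i t| <= 3 / n.+1%:R].
Proof.
move=> g1; have n0 : 0 < n.+1%:R :> R by rewrite ltr0n.
have [r [rc gr]] : exists r, locally_constant r /\
    forall t, `|g t - g (r t)| <= n.+1%:R^-1.
  by apply: locally_constant_approx; rewrite invr_gt0.
(* [v] rescales the range [-1, 1] to [0, n + 1], and [s i] is 1 where [v] exceeds [i] and -1
   elsewhere. Rounding [v] up costs at most [2 / n.+1] in the average, and [r] costs [1 / n.+1]. *)
pose v t := n.+1%:R * (g (r t) + 1) / 2.
exists (fun i t => 2 * (i%:R < v t)%R%:R - 1); split=> [i|i t|t].
- apply: locally_constant_continuous => t; have [a aP] := rc t.
  by exists a => u /aP ut; rewrite /v ut.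
- by case: ltP => _; rewrite ?mulr1 ?mulr0 ?sub0r ?normrN ?normr1// addrK normr1.
have /andP[gl gh] : -1 <= g (r t) <= 1 by rewrite -ler_norml -g1 sup_norm_ge.
have vE : n.+1%:R^-1 * v t = (g (r t) + 1) / 2.
  by rewrite /v -mulrA mulKf// gt_eqF.
have v0 : 0 <= v t by rewrite /v; apply: divr_ge0 => //; apply: mulr_ge0; lra.
have vn : v t <= n.+1%:R.
  by rewrite -(ler_pM2l (_ : 0 < n.+1%:R^-1)) ?invr_gt0// vE mulVf ?gt_eqF//; lra.
have /andP[] := count_below v0 vn.
rewrite sumrB -mulr_sumr sumr_const card_ord.
set N := \sum_(i < _) _.
rewrite -(ler_pM2l (_ : 0 < n.+1%:R^-1)) ?invr_gt0// vE => Nl.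
rewrite -(ler_pM2l (_ : 0 < n.+1%:R^-1)) ?invr_gt0// mulrDr vE mulr1 => Nh.
have := gr t; rewrite mulrBr mulVf ?gt_eqF//.
rewrite (mulrCA _ 2); set w := n.+1%:R^-1 * N in Nl Nh *.
rewrite !ler_norml; set q := n.+1%:R^-1 in Nl Nh *.
lra.
Qed.

End sign_averages.

(** * Uniform convex transitivity of the functions on the branches *)

Section convex_transitivity.
Context (R : realType) (K : pointedType) (d : Order.disp_t) (L : orderType d).
Hypothesis K_infinite : infinite_set [set: K].
Hypothesis L_wf : well_founded (fun a b : L => (a < b)%O).
Hypothesis L_limit : limit_order L.
Hypothesis card_nodes : nodes K L #= [set: K].

Lemma spread_peak (f : CB R (branches K L)) (s : branches K L -> R) (e : R)
    (a0 : L) (k0 : K) :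
  `|f| = 1 -> continuous s -> (forall t, `|s t| = 1) -> 0 < e -> e < 1 ->
  exists u : {linear CB R (branches K L) -> CB R (branches K L)},
    isometric_automorphism u /\
    forall t : branches K L, val t a0 <> Some k0 -> `|u f t - s t| <= e.
Proof.
move=> f1 sc us e0 e1; pose e2 := e / 2.
have [t ft] : exists t, 1 - e2 < `|f t|.
  apply: contrapT => /forallNP fN; have : `|f| <= 1 - e2.
    apply: sup_norm_le => [|t]; first by rewrite /e2; lra.
    by rewrite leNgt; apply/negP/fN.
  by rewrite f1 /e2; lra.
have e20 : 0 < e2 by rewrite /e2; lra.
have /cvgrPdist_le/(_ _ e20)/(nbhs_branches L_limit)[b bP] :=
  @cb_continuous _ _ f t.
have [h [h' [hc h'c hK h'K hb]]] :=
  homeomorphism_into_cone L_limit t b a0 k0 K_infinite card_nodes.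
(* [f t] is nonzero as [e < 1], so [c] is a sign. Then [c * f] exceeds [1 - e] on the cone: half of
   [e] is lost at [t], half by oscillation. *)
pose c := Num.sg (f t).
have c1 : `|c| = 1.
  by rewrite normr_sg -normr_gt0 (lt_trans _ ft)// subr_gt0 /e2; lra.
have cf : c * f t = `|f t| by rewrite normrEsg.
pose cs x := c * s x.
have csc : continuous cs.
  move=> x; have ? : Filter (nbhs x) := nbhs_filter x.
  by apply: cvgM; [exact: cvg_cst | exact: sc].
have ucs x : `|cs x| = 1 by rewrite normrM c1 us mulr1.
exists (weighted_comp csc hc ucs); split.
  exact: weighted_comp_isometric hK h'K.
move=> x /hb/bP fx; have fh1 : `|f (h x)| <= 1 by rewrite -f1 sup_norm_ge.
rewrite -[X in `|X|]/(c * s x * f (h x) - s x) mulrAC.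
rewrite -[in X in _ - X](mul1r (s x)).
rewrite -mulrBl normrM us mulr1.
have : `|c * f t - c * f (h x)| <= e2 by rewrite -mulrBr normrM c1 mul1r.
have : `|c * f (h x)| <= 1 by rewrite normrM c1 mul1r.
by rewrite cf !ler_norml; move: ft; rewrite /e2; lra.
Qed.

Lemma cb_sumE (S : topologicalType) n (F : 'I_n -> CB R S) x :
  (\sum_i F i : CB R S) x = \sum_i F i x.
Proof. exact: (big_morph (fun f : CB R S => f x)). Qed.

Lemma branches_uniformly_convex_transitive :
  uniformly_convex_transitive (CB R (branches K L)).
Proof.
move=> e e0; have [[a0] _] := L_limit.
have /infiniteP/pcard_injP[k kI] := K_infinite.
(* Of the 6, 3 comes from [sign_average] and 3 from replacing each [s i] by [u i f]. At least two
   operators are averaged, so that [q < 1]. *)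
pose n := (Num.trunc (6 / e)).+1.
have n0 : 0 < n.+1%:R :> R by rewrite ltr0n.
have en : 6 / n.+1%:R < e.
  rewrite ltr_pdivrMr// mulrC -ltr_pdivrMr//.
  by rewrite (lt_trans (truncnS_gt _))// ltr_nat.
exists n.+1 => f g f1 g1.
have [s [sc us gs]] := sign_average L_wf L_limit n g1.
pose q : R := n.+1%:R^-1.
have q0 : 0 < q by rewrite invr_gt0.
have q1 : q < 1 by rewrite invf_lt1// ltr1n.
have H (i : 'I_n.+1) :=
  spread_peak a0 (k i) f1 (sc i) (us i) q0 q1.
have [u uP] := choice H.
pose z := \sum_i q *: u i f.
have zP : orbit_hull n.+1 f z.
  exists u, (fun=> q); split=> //.
  - by move=> i; case: (uP i).
  - by move=> _; rewrite !ltW.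
  - by rewrite sumr_const card_ord -[_ *+ _]mulr_natr mulVf// gt_eqF.
have gz : `|g - z| < e.
  apply: le_lt_trans en; apply: sup_norm_le => [|t].
    by rewrite divr_ge0// ltW.
  rewrite -[X in `|X|]/(g t - z t).
  have -> : z t = q * \sum_i u i f t by rewrite cb_sumE mulr_sumr.
  rewrite -(subrKA (q * \sum_i s i t)) -mulrBr -sumrB.
  have le1 : `|\sum_i (s i t - u i f t)| <= n.+1%:R * q + 2.
    (* [P] marks the indices at which [u i f] may be far from [s i]. There is at most one, as [k] is
       injective, and its error is at most 2. *)
    pose P (i : 'I_n.+1) := `[< val t a0 = Some (k i) >].
    have le_i i : `|s i t - u i f t| <= q + 2 * (P i)%:R.
      have [ui uiP] := uP i; rewrite /P; case: asboolP => [_|/uiP]; last first.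
        by rewrite mulr0 addr0 distrC.
      rewrite mulr1 (le_trans (ler_normB _ _))// us.
      have : `|u i f t| <= 1 by rewrite -f1 -(ui.1 f) sup_norm_ge.
      by move: q0; lra.
    apply: le_trans (ler_norm_sum _ _ _) _.
    apply: le_trans (ler_sum _ (fun i _ => le_i i)) _.
    rewrite big_split /= sumr_const card_ord -mulr_sumr -[q *+ _]mulr_natl lerD2l.
    rewrite -[leRHS]mulr1 ler_wpM2l//; apply: sum_indicator_le1 => i j.
    move=> /asboolP ti /asboolP; rewrite ti => -[kij]; apply/val_inj.
    exact: (kI _ _ (mem_set I) (mem_set I)).
  have := ler_wpM2l (ltW q0) le1.
  rewrite mulrDr mulrA mulVf ?gt_eqF// mul1r => le2.
  rewrite (le_trans (ler_normD _ _))// (normrM q) (gtr0_norm q0).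
  by have := gs t; rewrite -/q; lra.
apply: (@le_trans _ _ (edist (g, z))).
  by apply: ereal_inf_lbound; exists z.
exact: edist_fin.
Qed.

End convex_transitivity.

Theorem theorem2p4 (R : realType) (K : Type) (d : Order.disp_t)
    (L : orderType d)
    (K_infinite : infinite_set [set: K])
    (L_wf : well_founded (fun a b : L => (a < b)%O))
    (L_limit : limit_order L)
    (card_nodes : nodes K L #= [set: K]) :
  [/\ CB0 (bounded_ideal K L)
        `<=` [set f : CB R (tree K L) | cb_restr (branches K L) f = 0],
      induces_isometry (CB0 (nodes_ideal K L))
        (@cb_restr R (tree K L) (branches K L))
    & uniformly_convex_transitive (CB R (branches K L))].
Proof.
have [k0 _] : [set: K] !=set0.
  by apply/set0P/negP => /eqP K0; apply: K_infinite; rewrite K0.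
(* An element of the infinite [K] serves as [point]. *)
pose Kp : pointedType := HB.pack_for pointedType K
  (gen_eqMixin K) (gen_choiceMixin K) (isPointed.Build K k0).
split.
- exact: (@CB0_restr R Kp d L L_wf L_limit _ ^~ (@bounded_ideal_nodes Kp d L)).
- exact: (@restr_induces_isometry R Kp d L L_wf L_limit).
- exact: (@branches_uniformly_convex_transitive
    R Kp d L K_infinite L_wf L_limit card_nodes).
Qed.
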